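(* Let $X$ be a Banach space with dual $X^*$ and let $(x_k)_{k\geq 1}$ be a bounded sequence in $X$. Then the following conditions are equivalent: (j) $(x_k)_{k\ge 1}$ is uniformly weakly mixing to zero, that is $$\lim_{n\to\infty}\ \sup\Big\{\frac 1n\sum_{k=1}^n|\langle x^*,x_k\rangle|\ ;\ x^*\in X^*,\ \|x^*\|\leq 1\Big\}=0.$$ (jj) For every sequence $k_1<k_2<\ldots$ in $\mathbb N^*$ of lower density $>0$, $$\lim_{n\to\infty}\Big\|\frac 1n\sum_{j=1}^n x_{k_j}\Big\|=0.$$ (jjj) For every relatively dense sequence $k_1<k_2<\ldots$ in $\mathbb N^*$, $$\lim_{n\to\infty}\Big\|\frac 1n\sum_{j=1}^n x_{k_j}\Big\|=0.$$
   Context: $\mathbb N^*=\{1,2,\ldots\}$. Banach spaces are real or complex. The lower density of $\mathcal A\subset\mathbb N^*$ is $D_*(\mathcal A)=\liminf_{n\to\infty}\frac 1n\,\mathrm{card}(\mathcal A\cap[1,n])$; the lower density of a sequence $(k_j)_{j\ge1}$ in $\mathbb N^*$ is that of the set $\{k_j\,;\,j\geq 1\}$. A set $\mathcal N\subset\mathbb N^*$ is relatively dense if there exists $L>0$ such that every interval of natural numbers of length $\geq L$ contains some element of $\mathcal N$; a sequence $(k_j)_{j\geq 1}$ in $\mathbb N^*$ is relatively dense if the set $\{k_j\,;\,j\ge 1\}$ is (for strictly increasing sequences this is equivalent to $\sup_{j}(k_{j+1}-k_j)<+\infty$). *)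

(* Defs.v *)
From HB Require Import structures.
From mathcomp Require Import all_boot all_order all_algebra.
From mathcomp Require Import finmap.
From mathcomp Require Import all_classical all_reals.
From mathcomp Require Import ereal topology normedtype sequences.
From mathcomp Require Import complex.

Set Implicit Arguments.
Unset Strict Implicit.
Unset Printing Implicit Defensive.

Import Order.TTheory GRing.Theory Num.Theory.
Import numFieldNormedType.Exports.

Local Open Scope classical_set_scope.
Local Open Scope ring_scope.
Local Open Scope complex_scope.

(* Sequences indexed by {1, 2, ...} are functions on nat whose value at 0 is
   never used. *)

(* The norm of a normed space over K takes its values in K.  The function re
   reads it as an element of R when suprema or extended reals are needed. *)
Variant real_or_complex (R : realType) :
    forall K : numFieldType, (K -> R) -> Prop :=
| RealScalars : @real_or_complex R R id
| ComplexScalars : @real_or_complex R R[i] (@complex.Re R).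

Section Defs.
Variable R : realType.

Definition lower_density (A : set nat) : \bar R :=
  limn_einf (fun n : nat =>
    (n%:R^-1 * #|` fset_set (A `&` [set k | (1 <= k <= n)%N]) |%:R)%:E).

Definition relatively_dense (A : set nat) : Prop :=
  exists2 L : nat, (0 < L)%N & forall a b : nat, (0 < a)%N -> (a + L <= b)%N ->
    exists2 m : nat, A m & (a <= m <= b)%N.

Definition increasing_pos (k : nat -> nat) : Prop :=
  (0 < k 1%N)%N /\ forall i j : nat, (0 < i)%N -> (i < j)%N -> (k i < k j)%N.

Definition terms (k : nat -> nat) : set nat := k @` [set j | (0 < j)%N].

Section Banach.
Variables (K : numFieldType) (re : K -> R) (X : normedModType K).

Definition dual_norm (f : X -> K) : \bar R :=
  ereal_sup [set (re `|f v|)%:E | v in [set v : X | `|v| <= 1]].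

Definition dual_unit_ball : set {linear X -> K^o} :=
  [set f : {linear X -> K^o} | continuous f /\ (dual_norm f <= 1)%E].

Definition uniformly_weakly_mixing (x : nat -> X) : Prop :=
  (fun n : nat =>
     ereal_sup [set (n%:R^-1 * \sum_(1 <= k < n.+1) re `|f (x k)|)%:E
               | f in dual_unit_ball]) @ \oo --> 0%E.

Definition ergodic_along (x : nat -> X) (k : nat -> nat) : Prop :=
  (fun n : nat => `|n%:R^-1 *: \sum_(1 <= j < n.+1) x (k j)|) @ \oo --> (0 : K).

End Banach.
End Defs.

(* Main.v *)
(** All three conditions are equivalent to: the largest norm of a subset sum
    [\sum_(k in F) x k], [F] a subset of {1..n}, is [o(n)].
    For uniform weak mixing this follows from the Hahn-Banach theorem together
    with [\sum_k |z k| <= 4 * |\sum_(k in F) z k|] for a suitable [F].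
    The sum of the first [n] terms along [k] is a subset sum over {1..k n}, and
    [k n = O(n)] when the lower density is positive.
    Conversely, if subset sums over [F_i] in {1..n_i} have norm [> e * n_i] with
    [n_i] growing fast, let [A] consist of the multiples of a large [L] and of
    the elements of [F_i] lying in (n_(i-1), n_i].  Then [A] is relatively dense,
    and its sum up to [n_i] differs from that of [F_i] by at most
    [M * (n_(i-1) + n_i / L)], so the means along [A] do not tend to zero. *)

From HB Require Import structures.
Require Import Defs.
From mathcomp Require Import all_boot all_order all_algebra.
From mathcomp Require Import finmap.
From mathcomp Require Import all_classical all_reals.
From mathcomp Require Import ereal topology normedtype sequences.
From mathcomp Require Import complex ring lra zify.

Set Implicit Arguments.
Unset Strict Implicit.
Unset Printing Implicit Defensive.

Import Order.TTheory GRing.Theory Num.Theory.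
Import numFieldNormedType.Exports.

Local Open Scope classical_set_scope.
Local Open Scope ring_scope.

(** * The Hahn-Banach theorem *)

Section Sublinear.
Variables (R : realType) (V : lmodType R).
Implicit Types (p q : V -> R) (u v w : V).

(** Only one inequality of positive homogeneity is required; the other follows by rescaling with the
    inverse of [t]. *)
Definition sublinear p :=
  (forall u v, p (u + v) <= p u + p v) /\
  (forall t v, 0 < t -> p (t *: v) <= t * p v).

Lemma sublinearZ p t v : sublinear p -> 0 < t -> p (t *: v) = t * p v.
Proof.
move=> [_ pZ] t0; apply/le_anti; rewrite pZ//=.
rewrite -ler_pdivlMl//; apply: le_trans (pZ _ _ _); rewrite ?invr_gt0//.
by rewrite scalerA mulVf ?gt_eqF// scale1r.
Qed.

Lemma sublinear0 p : sublinear p -> p 0 = 0.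
Proof. by move=> /(@sublinearZ p 2 0); rewrite scaler0 ltr0n => /(_ isT); lra. Qed.

Lemma sublinear_ge p v : sublinear p -> - p (- v) <= p v.
Proof.
by move=> sp; have := sp.1 v (- v); rewrite subrr sublinear0// -lerBlDr sub0r.
Qed.

(** For sublinear [q] this lowers [q] until it is linear along the line spanned by [u]: the value at
    [- u] becomes [- q u]. *)
Definition directional_inf q u v :=
  inf [set q (v + t *: u) - t * q u | t in [set t : R | 0 <= t]].

(** The infimum is finite because [t * q u = q (t *: u) <= q (- v) + q (v + t *: u)]. Parameters of
    two summands add up, scaling [v] scales the parameter, and the two upper bounds are the cases
    [t = 0] and [t = 1]. *)
Lemma directional_infP q u : sublinear q ->
  [/\ sublinear (directional_inf q u),
      forall v, directional_inf q u v <= q v &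
      forall v, directional_inf q u v <= q (v + u) - q u].
Proof.
move=> sq; have [qD _] := sq.
pose S v := [set q (v + t *: u) - t * q u | t in [set t : R | 0 <= t]].
have lbS v : has_lbound (S v).
  exists (- q (- v)) => _ [t /= t0 <-].
  have qtu : q (t *: u) = t * q u.
    move: t0; rewrite le_eqVlt => /predU1P[<-|t0]; last exact: sublinearZ.
    by rewrite scale0r mul0r sublinear0.
  have := qD (- v) (v + t *: u).
  by rewrite addKr qtu; lra.
have neS v : S v !=set0 by exists (q (v + 0 *: u) - 0 * q u), 0 => /=.
have leS v t : 0 <= t -> directional_inf q u v <= q (v + t *: u) - t * q u.
  by move=> t0; apply: (ge_inf (lbS v)); exists t.
split; first split.
- move=> v w; rewrite -lerBlDr; apply: (lb_le_inf (neS _)) => _ [s /= s0 <-].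
  rewrite lerBlDl -lerBlDr; apply: (lb_le_inf (neS _)) => _ [t /= t0 <-].
  have := leS (v + w) (s + t) (addr_ge0 s0 t0).
  have := qD (v + s *: u) (w + t *: u).
  by rewrite scalerDl addrACA; lra.
- move=> c v c0; rewrite -ler_pdivrMl//; apply: (lb_le_inf (neS _)) => _ [t /= t0 <-].
  rewrite ler_pdivrMl//; apply: le_trans (leS _ (c * t) _) _.
    by rewrite mulr_ge0// ltW.
  by rewrite -scalerA -scalerDr sublinearZ//; lra.
- by move=> v; have := leS v 0 (lexx 0); rewrite scale0r addr0 mul0r subr0.
- by move=> v; have := leS v 1 ler01; rewrite scale1r mul1r.
Qed.

(* Sublinear functionals are ordered by reversed pointwise comparison, so that
   Zorn's lemma yields a minimal one; a chain is bounded by its infimum. *)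
Lemma minimal_sublinear p : sublinear p ->
  exists2 q, sublinear q & (forall v, q v <= p v) /\
    forall r, sublinear r -> (forall v, r v <= q v) -> r = q.
Proof.
move=> sp.
pose below q := sublinear q /\ forall v, q v <= p v.
pose T := {q | below q}.
pose ord (q r : T) := `[< forall v, sval r v <= sval q v >].
have [|||A Atot|q qmin] := @Zorn T ord.
- by move=> q; apply/asboolP.
- move=> q r s /asboolP qr /asboolP rs; apply/asboolP => v.
  exact: le_trans (rs v) (qr v).
- move=> [q Hq] [r Hr] /asboolP /= qr /asboolP /= rq; apply: eq_exist.
  by apply/funext => v; apply/le_anti; rewrite qr rq.
(* The empty chain is bounded by [p] itself; the infimum is taken over a nonempty one. *)
- have [->|/set0P[a Aa]] := eqVneq A set0.
    by exists (exist below p (conj sp (fun=> lexx _))).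
  pose S v := [set sval r v | r in A].
  have lbS v : has_lbound (S v).
    exists (- p (- v)) => _ [[r [sr rp]] /= _ <-].
    by apply: le_trans (sublinear_ge v sr); rewrite lerN2.
  have neS v : S v !=set0 by exists (sval a v), a.
  have leS r v : A r -> inf (S v) <= sval r v.
    by move=> Ar; apply: (ge_inf (lbS v)); exists r.
  have sS : sublinear (fun v => inf (S v)).
    split=> [u v|c v c0].
      rewrite -lerBlDr; apply: (lb_le_inf (neS _)) => _ [r Ar <-].
      rewrite lerBlDl -lerBlDr; apply: (lb_le_inf (neS _)) => _ [s As <-].
      (* The smaller of [r] and [s] lies below both, so its own subadditivity suffices. *)
      rewrite lerBlDl; have [/asboolP rs|/asboolP sr] := Atot r s Ar As.
        apply: le_trans (leS s _ As) _; apply: le_trans ((svalP s).1.1 _ _) _.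
        by rewrite lerD2r.
      apply: le_trans (leS r _ Ar) _; apply: le_trans ((svalP r).1.1 _ _) _.
      by rewrite lerD2l.
    rewrite -ler_pdivrMl//; apply: (lb_le_inf (neS _)) => _ [r Ar <-].
    rewrite ler_pdivrMl//; apply: le_trans (leS r _ Ar) _.
    exact: (svalP r).1.2.
  have Sp v : inf (S v) <= p v by apply: le_trans (leS a v Aa) ((svalP a).2 v).
  exists (exist below _ (conj sS Sp)) => r Ar; apply/asboolP => v /=; exact: leS.
- case: q qmin => q [sq qp] qmin; exists q => //; split=> // r sr rq.
  have rp v : r v <= p v by apply: le_trans (rq v) (qp v).
  have := qmin (exist below r (conj sr rp)).
  by move=> /(_ (introT (asboolP _) rq))/(congr1 sval).
Qed.

(* A minimal sublinear functional [g] coincides with each [directional_inf g u],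
   hence [g v <= g (v + u) - g u]: it is additive.  Starting from
   [directional_inf p v0] instead of [p] forces [g v0 = p v0]. *)
Lemma sublinear_dominates_linear p v0 : sublinear p ->
  exists2 g : {scalar V}, (forall v, g v <= p v) & g v0 = p v0.
Proof.
move=> sp; have [sp0 p0p p0v] := directional_infP v0 sp.
have [g sg [gp0 gmin]] := minimal_sublinear sp0.
have gD u v : g (u + v) = g u + g v.
  have [sg' g'g g'v] := directional_infP u sg.
  have := g'v v; rewrite (gmin _ sg' g'g) (addrC v) => guv.
  by apply/le_anti; rewrite sg.1/=; lra.
have gN v : g (- v) = - g v.
  by apply/eqP; rewrite -addr_eq0 -gD addNr sublinear0.
have gZ (t : R) v : g (t *: v) = t * g v.
  have [t0|t0|->] := ltgtP t 0.
  - by rewrite -{1}[t]opprK scaleNr gN sublinearZ ?oppr_gt0// mulNr opprK.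
  - exact: sublinearZ.
  - by rewrite scale0r mul0r sublinear0.
have glin : linear_for *%R g by move=> t u v; rewrite gD gZ.
pose G : {scalar V} := HB.pack g (GRing.isLinear.Build R V R *%R g glin).
have gp v : g v <= p v by apply: le_trans (gp0 v) (p0p v).
exists G => //=; apply/le_anti; rewrite gp/=.
(* At [- v0] the bound reads [g (- v0) <= p 0 - p v0]; as [g] is odd, [p v0 <= g v0]. *)
have := le_trans (gp0 (- v0)) (p0v (- v0)).
by rewrite addNr sublinear0// sub0r gN lerN2.
Qed.

End Sublinear.

(** * The real vector space underlying a complex one *)

Section RestrictionOfScalars.
Variables (R : realType) (V : lmodType R[i]).
Local Open Scope complex_scope.

(** The alias keeps the real module structure apart from the complex one on the same group. *)
Definition restrict_scalars : Type := V.
HB.instance Definition _ := GRing.Zmodule.on restrict_scalars.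

Definition restrict_scale (t : R) (v : restrict_scalars) : restrict_scalars :=
  t%:C *: (v : V).

Lemma restrict_scaleA s t v :
  restrict_scale s (restrict_scale t v) = restrict_scale (s * t) v.
Proof. by rewrite /restrict_scale scalerA rmorphM. Qed.

Lemma restrict_scale1 : left_id 1 restrict_scale.
Proof. by move=> v; rewrite /restrict_scale rmorph1 scale1r. Qed.

Lemma restrict_scaleDr : right_distributive restrict_scale +%R.
Proof. by move=> t u v; rewrite /restrict_scale scalerDr. Qed.

Lemma restrict_scaleDl v : {morph restrict_scale^~ v : s t / s + t}.
Proof. by move=> s t; rewrite /restrict_scale rmorphD scalerDl. Qed.

HB.instance Definition _ := GRing.Zmodule_isLmodule.Build R restrict_scalars
  restrict_scaleA restrict_scale1 restrict_scaleDr restrict_scaleDl.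

End RestrictionOfScalars.

(** * Norms and dual balls over real and complex scalars alike *)

Section Scalars.
Variables (R : realType) (K : numFieldType) (re : K -> R).
Hypothesis hK : real_or_complex re.

(** Common interface to both fields: nonnegative elements of [K] come from [R], so order and
    arithmetic of [re] on them can be read in [R]. *)
Lemma real_or_complexP : exists iota : {rmorphism R -> K},
  [/\ {mono iota : a b / a <= b}, cancel iota re &
      forall z, 0 <= z -> iota (re z) = z].
Proof.
case: hK => [|]; first by exists idfun.
exists (real_complex R); split => // [a b|z z0]; first exact: lecR.
exact: RRe_real (ger0_real z0).
Qed.

Lemma re_le z w : 0 <= z -> 0 <= w -> (re z <= re w) = (z <= w).
Proof.
by move=> z0 w0; have [i [im _ iK]] := real_or_complexP; rewrite -im !iK.
Qed.

Lemma reD z w : 0 <= z -> 0 <= w -> re (z + w) = re z + re w.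
Proof.
move=> z0 w0; have [i [im ik iK]] := real_or_complexP.
by rewrite -{1}(iK _ z0) -{1}(iK _ w0) -rmorphD ik.
Qed.

Lemma reM z w : 0 <= z -> 0 <= w -> re (z * w) = re z * re w.
Proof.
move=> z0 w0; have [i [im ik iK]] := real_or_complexP.
by rewrite -{1}(iK _ z0) -{1}(iK _ w0) -rmorphM ik.
Qed.

Lemma re_nat n : re n%:R = n%:R.
Proof. by have [i [_ ik _]] := real_or_complexP; rewrite -(rmorph_nat i) ik. Qed.

Lemma re0 : re 0 = 0. Proof. exact: (re_nat 0). Qed.

Lemma re1 : re 1 = 1. Proof. exact: (re_nat 1). Qed.

Lemma re_natV n : re n%:R^-1 = n%:R^-1.
Proof.
have [i [_ ik _]] := real_or_complexP.
by rewrite -(rmorph_nat i) -fmorphV ik.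
Qed.

Lemma re_ge0 z : 0 <= z -> 0 <= re z.
Proof. by move=> z0; rewrite -re0 re_le. Qed.

Section NormedModule.
Variable X : normedModType K.
Implicit Types v : X.

Lemma re_norm_ge0 v : 0 <= re `|v|. Proof. exact: re_ge0. Qed.

Lemma re_normD v w : re `|v + w| <= re `|v| + re `|w|.
Proof. by rewrite -reD// re_le ?addr_ge0// ler_normD. Qed.

Lemma re_norm_sum (I : Type) (s : seq I) (P : pred I) (x : I -> X) :
  re `|\sum_(i <- s | P i) x i| <= \sum_(i <- s | P i) re `|x i|.
Proof.
elim/big_ind2: _ => // [|v a w b va wb]; first by rewrite normr0 re0.
exact: le_trans (re_normD _ _) (lerD va wb).
Qed.

Lemma contraction_dual_unit_ball (f : {linear X -> K^o}) :
  (forall v, `|f v| <= `|v|) -> dual_unit_ball re f.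
Proof.
move=> fle; split.
  apply/linear_bounded_continuous/linear_boundedP.
  near=> r => v; apply: le_trans (fle v) _.
  rewrite -[leLHS]mul1r ler_wpM2r//; near: r; apply: nbhs_pinfty_ge.
apply: ge_ereal_sup => _ [v /= v1 <-]; rewrite lee_fin -[leRHS]re1.
by rewrite re_le// (le_trans (fle v)).
Unshelve. all: by end_near. Qed.

(** The dual norm sees only the unit ball, so a nonzero [v] is divided by its norm, which is itself
    a scalar of [K]. *)
Lemma dual_unit_ball_contraction (f : {linear X -> K^o}) v :
  dual_unit_ball re f -> re `|f v| <= re `|v|.
Proof.
move=> [_ f1]; have [->|v0] := eqVneq v 0; first by rewrite linear0 !normr0.
have nv0 : 0 < `|v| by rewrite normr_gt0.
have : ((re `|f (`|v|^-1 *: v)|)%:E <= 1)%E.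
  apply: le_trans f1; apply: ereal_sup_ubound; exists (`|v|^-1 *: v) => //=.
  by rewrite normrZ normfV normr_id mulVf// gt_eqF.
rewrite lee_fin linearZ normrZ normfV normr_id -[leRHS]re1.
by rewrite !re_le ?mulr_ge0 ?invr_ge0// ler_pdivrMl// mulr1.
Qed.

End NormedModule.
End Scalars.

(** * Norming functionals *)

Section Norming.
Variable R : realType.

(** The norm is sublinear; a linear [g] below it satisfies the bound at both [w] and [- w], hence is
    a contraction. *)
Lemma real_norming_functional (X : normedModType R) (v : X) :
  exists2 f : {linear X -> R^o}, dual_unit_ball (R := R) id f & `|v| <= `|f v|.
Proof.
have sn : sublinear (fun w : X => `|w|).
  by split=> [u w|t w t0]; rewrite ?ler_normD// normrZ gtr0_norm.
have [g gn gv] := sublinear_dominates_linear v sn.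
exists (g : {linear X -> R^o}); last by rewrite -gv ler_norm.
apply: contraction_dual_unit_ball => [|w]; first exact: RealScalars.
by rewrite ler_norml gn andbT lerNl -linearN/= -normrN gn.
Qed.

Local Open Scope complex_scope.

(* A real functional g is the real part of w |-> g w - i g (i w). *)
Lemma complex_norming_functional (X : normedModType R[i]) (v : X) :
  exists2 f : {linear X -> R[i]^o},
    dual_unit_ball (@complex.Re R) f & complex.Re `|v| <= complex.Re `|f v|.
Proof.
have cC := ComplexScalars R.
have sn : @sublinear R (restrict_scalars X) (fun w => complex.Re `|w : X|).
  split=> [u w|t w t0]; first exact: (re_normD cC).
  rewrite [_ *: _]/(t%:C *: (w : X)) normrZ (reM cC)//.
  by rewrite ger0_norm// lecR ltW.
have [g gn gv] := sublinear_dominates_linear (v : restrict_scalars X) sn.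
pose f (w : X) : R[i] := g w +i* (- g ('i *: w)).
have gC (t : R) (w : X) : g (t%:C *: w) = t * g w by exact: (scalarZ g t w).
have gD (u w : X) : g (u + w) = g u + g w by exact: (linearD g u w).
have flin : linear (f : X -> R[i]^o).
  move=> [a b] u w.
  have uE : (a +i* b) *: u = a%:C *: u + b%:C *: ('i *: u).
    by rewrite scalerA -scalerDl; congr (_ *: _); simpc.
  have iuE : 'i *: ((a +i* b) *: u) = a%:C *: ('i *: u) + (- b)%:C *: u.
    by rewrite !scalerA -scalerDl; congr (_ *: _); simpc.
  rewrite /f scalerDr iuE uE !gD !gC [RHS]/((a +i* b) * (_ +i* _) + _ +i* _).
  by apply/eqP; rewrite eq_complex /=; apply/andP; split; apply/eqP; ring.
pose F : {linear X -> R[i]^o} := HB.pack f (GRing.isLinear.Build _ _ _ _ _ flin).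
exists F; last first.
  rewrite -gv; have := normc_ge_Re (f v); rewrite lecE /= => /andP[_].
  by apply: le_trans; exact: ler_norm.
apply: (contraction_dual_unit_ball cC) => w; change (`|f w : R[i]| <= `|w|).
have [->|fw0] := eqVneq (f w) 0; first by rewrite normr0.
(* Rotating [w] by the unimodular [z] makes the value of [f] real and nonnegative, hence equal to
   [g (z *: w)], which the norm dominates. *)
pose z : R[i] := `|f w| / f w.
have z1 : `|z| = 1 by rewrite normrM normfV normr_id divff// normr_eq0.
have zfw : f (z *: w) = `|f w|.
  have -> : f (z *: w) = z * f w by exact: (linearZ_LR F).
  by rewrite mulfVK.
have gz : g (z *: w) = complex.Re `|f w| by rewrite -zfw.
by rewrite -(re_le cC)// -gz (le_trans (gn _))// normrZ z1 mul1r.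
Qed.

End Norming.

Lemma norming_functional (R : realType) (K : numFieldType) (re : K -> R)
    (hK : real_or_complex re) (X : normedModType K) (v : X) :
  exists2 f : {linear X -> K^o}, dual_unit_ball re f & re `|v| <= re `|f v|.
Proof.
case: hK X v; [exact: real_norming_functional|exact: complex_norming_functional].
Qed.

(** * Counting in sets of natural numbers *)

Section Counting.
Implicit Types (k : nat -> nat) (A : set nat).

Lemma increasing_pos_ge k n : increasing_pos k -> (n <= k n)%N.
Proof.
move=> [k1 kinc]; elim: n => // -[//|n] IH.
exact: leq_ltn_trans IH (kinc _ _ _ (ltnSn _)).
Qed.

Lemma increasing_pos_leq k i j : increasing_pos k -> (0 < i)%N -> (0 < j)%N ->
  (k i <= k j)%N = (i <= j)%N.
Proof.
move=> [_ kinc] i0 j0; case: (ltngtP i j) => [ij|ji|->]; last exact: leqnn.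
  by rewrite ltnW// kinc.
by rewrite leqNgt kinc.
Qed.

Lemma increasing_pos_last k n : increasing_pos k ->
  exists m, forall j, (0 < j)%N -> (k j <= n)%N = (j <= m)%N.
Proof.
move=> kP; pose Q j := (j == 0)%N || (k j <= n)%N.
have Q0 : exists j, Q j by exists 0%N.
have Qn j : Q j -> (j <= n)%N.
  by case/predU1P => [->//|]; apply: leq_trans (increasing_pos_ge j kP).
case: (ex_maxnP Q0 Qn) => m Qm mmax; exists m => j j0; apply/idP/idP => [kj|jm].
  by apply: mmax; rewrite /Q kj orbT.
have m0 : (0 < m)%N by exact: leq_trans jm.
move: Qm; rewrite /Q gtn_eqF//=; apply: leq_trans.
by rewrite increasing_pos_leq.
Qed.

(** Both lists are strictly increasing and have the same elements. This turns sums along [k] into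
    subset sums. *)
Lemma filter_terms k n m : increasing_pos k ->
  (forall j, (0 < j)%N -> (k j <= n)%N = (j <= m)%N) ->
  [seq i <- index_iota 1 n.+1 | i \in terms k] = [seq k j | j <- index_iota 1 m.+1].
Proof.
move=> kP kn.
have sk : sorted ltn [seq k j | j <- index_iota 1 m.+1].
  rewrite sorted_map; apply: (@sub_in_sorted _ (fun j => 0 < j)%N ltn).
  - by move=> i j i0 _; exact: kP.2 _ _ i0.
  - by apply/allP => j; rewrite mem_index_iota => /andP[].
  - exact: iota_ltn_sorted.
apply: (irr_sorted_eq ltn_trans ltnn) => //.
  exact: sorted_filter ltn_trans _ _ (iota_ltn_sorted _ _).
move=> i; rewrite mem_filter mem_index_iota; apply/idP/mapP.
  move=> /andP[/set_mem[j /= j0 <-]] /andP[_ kjn].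
  by exists j => //; rewrite mem_index_iota j0 ltnS -kn.
move=> [j]; rewrite mem_index_iota ltnS => /andP[j0 jm] ->.
rewrite ltnS kn// jm andbT (leq_trans j0 (increasing_pos_ge j kP)) andbT.
by apply/mem_set; exists j.
Qed.

Lemma sum_terms (V : nmodType) (x : nat -> V) k n m : increasing_pos k ->
  (forall j, (0 < j)%N -> (k j <= n)%N = (j <= m)%N) ->
  \sum_(1 <= j < m.+1) x (k j) = \sum_(1 <= i < n.+1 | i \in terms k) x i.
Proof. by move=> kP kn; rewrite -[RHS]big_filter (filter_terms kP kn) big_map. Qed.

Lemma card_fset_set_interval A n :
  #|` fset_set (A `&` [set k | (1 <= k <= n)%N])| =
  count (mem A) (index_iota 1 n.+1).
Proof.
pose s := [seq i <- index_iota 1 n.+1 | i \in A].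
have us : uniq s by rewrite filter_uniq// iota_uniq.
rewrite -size_filter -[RHS]/(size s) -(undup_id us) -card_fseq.
suff -> : A `&` [set k | (1 <= k <= n)%N] = [set` [fset i in s]%fset].
  by rewrite set_fsetK.
apply/seteqP; split=> i /=; rewrite inE mem_filter mem_index_iota.
  by move=> [/mem_set-> ->].
by move=> /andP[/set_mem Ai ?]; split.
Qed.

(** The lower limit is the supremum of the infima over tails, so it is positive exactly when some
    tail has a positive infimum. *)
Lemma lower_density_gt0P (R : realType) A : (0 < lower_density R A)%E <->
  exists2 d : R, 0 < d & exists n0, forall n, (n0 <= n)%N ->
    d * n%:R <= (count (mem A) (index_iota 1 n.+1))%:R.
Proof.
rewrite /lower_density limn_einf_lim (cvg_lim _ (@cvg_einfs_sup _ _))//.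
pose u n : \bar R := (n%:R^-1 * (count (mem A) (index_iota 1 n.+1))%:R)%:E.
rewrite [X in einfs X](_ : _ = u); last first.
  by apply/funext => n; rewrite card_fset_set_interval.
split=> [/ereal_sup_gt[_ [m _ <-] um]|[d d0 [n0 dn]]].
  have le_u n : (m <= n)%N -> (einfs u m <= u n)%E.
    by move=> mn; apply: ereal_inf_lbound; exists n.
  have ufin : einfs u m \is a fin_num.
    by rewrite ge0_fin_numE ?ltW// (le_lt_trans (le_u m _))// ltry.
  exists (fine (einfs u m)); first by rewrite fine_gt0// um ltey_eq ufin.
  (* Starting at 1 or later avoids [n = 0], whose inverse is 0 by convention. *)
  exists (maxn m 1) => n; rewrite geq_max => /andP[mn n0].
  by rewrite -ler_pdivlMr ?ltr0n// mulrC -lee_fin fineK// le_u.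
apply: (@lt_le_trans _ _ d%:E); first by rewrite lte_fin.
apply: (@le_trans _ _ (einfs u (maxn n0 1))); last first.
  by apply: ereal_sup_ubound; exists (maxn n0 1).
apply: le_ereal_inf_tmp => _ [n /= nn <-]; move: nn.
rewrite geq_max => /andP[n0n n1]; rewrite lee_fin mulrC ler_pdivlMr ?ltr0n//.
exact: dn.
Qed.

(** The interval splits into [n] blocks of [L.+1] consecutive integers, each meeting [A]. *)
Lemma relatively_dense_count A L n :
  (forall a b, (0 < a)%N -> (a + L <= b)%N -> exists2 m, A m & (a <= m <= b)%N) ->
  (n <= count (mem A) (index_iota 1 (n * L.+1).+1))%N.
Proof.
move=> AL; elim: n => // n IH.
have [m Am mn] := AL (n * L.+1).+1 (n.+1 * L.+1)%N isT ltac:(lia).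
rewrite /index_iota !subSS !subn0 in IH *.
rewrite mulSn addnC iotaD count_cat -addn1 leq_add// -has_count.
apply/hasP; exists m; last exact/mem_set.
by rewrite mem_iota; move: mn; lia.
Qed.

(** Starting from the value 0 at index 0, each term is the least element of [A] above the previous
    one. *)
Lemma enumerate_infinite A : (forall a, exists2 b, A b & (a < b)%N) ->
  exists2 k, increasing_pos k & terms k = A `&` [set n | (0 < n)%N].
Proof.
move=> Ainf.
have ex a : exists b, (b \in A) && (a < b)%N.
  by have [b /mem_set Ab ab] := Ainf a; exists b; rewrite Ab.
pose next a := ex_minn (ex a); pose k j := iter j next 0%N.
have nextP a : [/\ A (next a), (a < next a)%N &
    forall b, A b -> (a < b)%N -> (next a <= b)%N].
  rewrite /next; case: ex_minnP => b /andP[/set_mem Ab ab] bmin; split => // c Ac ac.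
  by apply: bmin; rewrite ac mem_set.
have kS j : (k j < k j.+1)%N by have [] := nextP (k j).
have kinc i j : (i < j)%N -> (k i < k j)%N.
  exact: (homo_ltn ltn_trans kS).
exists k; first by split=> [|i j _]; [exact: kS 0%N|exact: kinc].
apply/seteqP; split=> [_ [[//|j] _ <-]|a [Aa a0]].
  by have [Ak ? _] := nextP (k j); split=> //=; apply: leq_ltn_trans (kS j).
(* At the least index [j.+1] whose term reaches [a], the previous term is below [a], so the least
   element of [A] above it is at most [a]. *)
have exk : exists j, (a <= k j)%N.
  exists a; elim: (a) => // b IH; exact: leq_ltn_trans IH (kS b).
case: (ex_minnP exk) => -[|j] aj jmin; first by move: aj; rewrite leqNgt a0.
exists j.+1 => //; apply/eqP; rewrite eqn_leq aj andbT.
have [_ _] := nextP (k j); apply=> //.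
by rewrite ltnNge; apply/negP => /jmin; rewrite ltnn.
Qed.

End Counting.

(** * Subset sums *)

(** Either the nonnegative or the negative terms carry at least half of the total absolute value,
    without cancellation. *)
Lemma real_subset_sum (R : realDomainType) (I : Type) (s : seq I) (z : I -> R) :
  exists P : pred I, \sum_(i <- s) `|z i| <= 2 * `|\sum_(i <- s | P i) z i|.
Proof.
pose P i := 0 <= z i.
have posE : `|\sum_(i <- s | P i) z i| = \sum_(i <- s | P i) `|z i|.
  rewrite ger0_norm ?sumr_ge0//.
  by apply: eq_bigr => i zi; rewrite ger0_norm.
have negE : `|\sum_(i <- s | ~~ P i) z i| = \sum_(i <- s | ~~ P i) `|z i|.
  rewrite -normrN -sumrN ger0_norm; last first.
    by rewrite sumr_ge0// => i; rewrite /P oppr_ge0 -ltNge => /ltW.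
  by apply: eq_bigr => i; rewrite /P -ltNge => zi; rewrite ltr0_norm.
have [sp|sn] := lerP (\sum_(i <- s | ~~ P i) `|z i|) (\sum_(i <- s | P i) `|z i|).
  by exists P; rewrite (bigID P)/= posE; lra.
by exists (predC P); rewrite (bigID P)/= negE; lra.
Qed.

Section Sequences.
Variables (R : realType) (K : numFieldType) (re : K -> R).
Hypothesis hK : real_or_complex re.

(** In the complex case, real and imaginary parts each cost a factor 2, and keeping the better of
    the two subsets costs another 2. *)
Lemma scalar_subset_sum (I : Type) (s : seq I) (z : I -> K) :
  exists P : pred I,
    \sum_(i <- s) re `|z i| <= 4 * re `|\sum_(i <- s | P i) z i|.
Proof.
case: hK z => z.
  have [P hP] := real_subset_sum s z; exists P; apply: le_trans hP _.
  by rewrite ler_wpM2r// ler_nat.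
have re_norm (w : R[i]) : `|complex.Re w| <= complex.Re `|w|.
  by have := normc_ge_Re w; rewrite lecE => /andP[].
have im_norm (w : R[i]) : `|complex.Im w| <= complex.Re `|w|.
  by rewrite normc_def/= -sqrtr_sqr ler_wsqrtr// lerDr sqr_ge0.
have norm_le (w : R[i]) : complex.Re `|w| <= `|complex.Re w| + `|complex.Im w|.
  rewrite normc_def/= -[leRHS]ger0_norm ?addr_ge0// -sqrtr_sqr ler_wsqrtr//.
  rewrite sqrrD !real_normK ?num_real// -addrA lerD2l lerDr.
  by rewrite mulrn_wge0// mulr_ge0.
have [P1 hP1] := real_subset_sum s (fun i => complex.Re (z i)).
have [P2 hP2] := real_subset_sum s (fun i => complex.Im (z i)).
have ReE P : \sum_(i <- s | P i) complex.Re (z i) =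
    complex.Re (\sum_(i <- s | P i) z i).
  by rewrite (raddf_sum (@complex.Re R : Rcomplex R -> R)).
have ImE P : \sum_(i <- s | P i) complex.Im (z i) =
    complex.Im (\sum_(i <- s | P i) z i).
  by rewrite (raddf_sum (@complex.Im R : Rcomplex R -> R)).
have sum_le : \sum_(i <- s) complex.Re `|z i| <=
    2 * complex.Re `|\sum_(i <- s | P1 i) z i| +
    2 * complex.Re `|\sum_(i <- s | P2 i) z i|.
  apply: le_trans (ler_sum _ (fun i _ => norm_le (z i))) _.
  rewrite big_split lerD// ?(le_trans hP1)// ?(le_trans hP2)//=.
    by rewrite ler_pM2l// ReE re_norm.
  by rewrite ler_pM2l// ImE im_norm.
have [h|h] := lerP (complex.Re `|\sum_(i <- s | P1 i) z i|)
  (complex.Re `|\sum_(i <- s | P2 i) z i|); [exists P2|exists P1]; lra.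
Qed.

Variable X : normedModType K.
Implicit Types x : nat -> X.

Definition small_subset_sums x := forall e : R, 0 < e ->
  exists n0, forall n (P : pred nat), (n0 <= n)%N ->
    re `|\sum_(1 <= k < n.+1 | P k) x k| <= e * n%:R.

Lemma uniformly_weakly_mixingP x : uniformly_weakly_mixing re x <->
  forall e : R, 0 < e -> exists n0, forall n (f : {linear X -> K^o}),
    (n0 <= n)%N -> dual_unit_ball re f ->
    \sum_(1 <= k < n.+1) re `|f (x k)| <= e * n%:R.
Proof.
rewrite /uniformly_weakly_mixing; set u := fun n : nat => ereal_sup _.
(* The zero functional excludes the value minus infinity, so any real upper bound makes [u n]
   finite. *)
have u0 n : (0 <= u n)%E.
  pose f0 : {linear X -> K^o} := \0.
  apply: ereal_sup_ubound; exists f0.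
    by apply: (contraction_dual_unit_ball hK) => v; rewrite normr0.
  by rewrite big1 ?mulr0// => i _; rewrite normr0 (re0 hK).
have u_le n (e : R) : (0 < n)%N -> (u n <= e%:E)%E <->
    forall f : {linear X -> K^o}, dual_unit_ball re f ->
    \sum_(1 <= k < n.+1) re `|f (x k)| <= e * n%:R.
  move=> n0; split=> [ue f fb|fe].
    rewrite -ler_pdivrMr ?ltr0n// mulrC -lee_fin; apply: le_trans ue.
    by apply: ereal_sup_ubound; exists f.
  apply: ge_ereal_sup => _ [f fb <-].
  by rewrite lee_fin mulrC ler_pdivrMr ?ltr0n// fe.
split=> [/fine_cvgP[ufin /cvgrPdist_le uc] e e0|ue].
  have [n0 _ hn0] := filterI ufin (uc e e0).
  exists (maxn n0 1) => n f; rewrite geq_max => /andP[/hn0[/= un une] n1].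
  apply: (u_le n e n1).1; rewrite -(fineK un) lee_fin.
  by move: une; rewrite sub0r normrN; apply: le_trans; exact: ler_norm.
have ue' e : 0 < e -> \forall n \near \oo, (u n <= e%:E)%E.
  move=> e0; have [n0 hn0] := ue e e0; exists (maxn n0 1) => // n /=.
  by rewrite geq_max => /andP[n0n n1]; apply/u_le => // f; exact: hn0.
have ufin n e : (u n <= e%:E)%E -> u n \is a fin_num.
  by move=> une; rewrite ge0_fin_numE// (le_lt_trans une)// ltry.
apply/fine_cvgP; split; first by apply: filterS (ue' 1 ltr01) => n; exact: ufin.
apply/cvgrPdist_le => e e0; apply: filterS (ue' e e0) => n une /=.
rewrite sub0r normrN ger0_norm ?fine_ge0// -lee_fin fineK//; exact: ufin une.
Qed.

(** The limit is taken in [K], but every positive tolerance in [K] is the image of a positive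
    real. *)
Lemma ergodic_alongP x k : ergodic_along x k <->
  forall e : R, 0 < e -> exists n0, forall n, (n0 <= n)%N ->
    re `|\sum_(1 <= j < n.+1) x (k j)| <= e * n%:R.
Proof.
have [i [im ik iK]] := real_or_complexP hK.
pose S n := \sum_(1 <= j < n.+1) x (k j).
have avg n (e : K) : (0 < n)%N -> 0 <= e ->
    (`|0 - `|n%:R^-1 *: S n| | <= e) = (re `|S n| <= re e * n%:R).
  move=> n0 e0; rewrite sub0r normrN normr_id normrZ normfV normr_nat.
  rewrite -(re_le hK)// ?mulr_ge0 ?invr_ge0// (reM hK) ?invr_ge0//.
  by rewrite (re_natV hK) ler_pdivrMl ?ltr0n// mulrC.
split=> [/cvgrPdist_le xk e e0|xk].
  have ie0 : 0 < i e by rewrite -(rmorph0 i) (leW_mono im).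
  have [n0 _ hn0] := xk _ ie0.
  exists (maxn n0 1) => n; rewrite geq_max => /andP[/hn0/= + n1].
  by rewrite avg ?(ltW ie0)// ik.
rewrite /ergodic_along; apply/cvgrPdist_le => e e0.
have re0 : 0 < re e.
  by rewrite lt_neqAle (re_ge0 hK) ?ltW// andbT -(inj_eq (fmorph_inj i)) rmorph0
    iK ?ltW// eq_sym gt_eqF.
have [n0 hn0] := xk _ re0; exists (maxn n0 1) => // n /=.
by rewrite geq_max => /andP[/hn0 + n1]; rewrite avg ?(ltW e0).
Qed.

Lemma bounded_re x : [bounded x k | k in [set k : nat | (0 < k)%N]] ->
  exists2 M : R, 0 <= M & forall k, (0 < k)%N -> re `|x k| <= M.
Proof.
move=> [M [Mr hM]]; exists (re (`|M| + 1)).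
  by rewrite (re_ge0 hK)// addr_ge0.
move=> k k0; rewrite (re_le hK) ?addr_ge0//; apply: hM => //.
by rewrite (le_lt_trans (real_ler_norm Mr))// ltrDl.
Qed.

(** A functional norming the subset sum bounds it by a sum of absolute values, which only grows when
    [P] is dropped. Conversely [scalar_subset_sum] loses a factor 4, whence the tolerance
    [e / 4]. *)
Lemma mixing_small_subset_sums x :
  uniformly_weakly_mixing re x <-> small_subset_sums x.
Proof.
rewrite uniformly_weakly_mixingP; split=> [xm e e0|xs e e0].
  have [n0 hn0] := xm e e0; exists n0 => n P n0n.
  have [f fb] := norming_functional hK (\sum_(1 <= k < n.+1 | P k) x k).
  move=> /le_trans; apply; apply: le_trans (hn0 n f n0n fb).
  rewrite linear_sum; apply: le_trans (re_norm_sum hK _ _ _) _.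
  rewrite [leRHS](bigID P)/= lerDl sumr_ge0// => i _; exact: re_norm_ge0.
have [n0 hn0] := xs (e / 4) (divr_gt0 e0 (ltr0Sn _ _)).
exists n0 => n f n0n fb.
have [P hP] := scalar_subset_sum (index_iota 1 n.+1) (f \o x).
apply: le_trans hP _; rewrite -ler_pdivlMl// mulrA (mulrC _ e).
apply: le_trans (hn0 n P n0n); rewrite -linear_sum.
exact: dual_unit_ball_contraction.
Qed.

Lemma small_subset_sums_ergodic x k : small_subset_sums x -> increasing_pos k ->
  (0 < lower_density R (terms k))%E -> ergodic_along x k.
Proof.
move=> xs kP /lower_density_gt0P[d d0 [n0 hd]]; apply/ergodic_alongP => e e0.
(* Exactly [n] terms are at most [k n], so the density bound gives [d * k n <= n], and [e * d * k n]
   is at most [e * n]. *)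
have [n1 hx] := xs (e * d) (mulr_gt0 e0 d0).
exists (maxn 1 (maxn n0 n1)) => n; rewrite !geq_max => /and3P[n_gt0 n0n n1n].
have kn j : (0 < j)%N -> (k j <= k n)%N = (j <= n)%N.
  by move=> j0; exact: increasing_pos_leq.
have nkn := increasing_pos_ge n kP.
rewrite (sum_terms _ kP kn); apply: le_trans (hx _ _ (leq_trans n1n nkn)) _.
rewrite -mulrA ler_pM2l//; apply: le_trans (hd _ (leq_trans n0n nkn)) _.
rewrite -size_filter (filter_terms kP kn) size_map size_iota subSS subn0.
exact: lexx.
Qed.

End Sequences.

(** Once [n] is at least [L.+1], the number [q] of complete blocks is positive and
    [n < q.+1 * L.+1 <= 2 * q * L.+1]; hence the constant. *)
Lemma relatively_dense_lower_density (R : realType) (A : set nat) :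
  relatively_dense A -> (0 < lower_density R A)%E.
Proof.
move=> [L L0 AL]; apply/lower_density_gt0P; exists (2 * L.+1)%:R^-1.
  by rewrite invr_gt0 ltr0n.
exists L.+1 => n Ln; rewrite mulrC ler_pdivrMr ?ltr0n// -natrM ler_nat.
have q0 : (0 < n %/ L.+1)%N by rewrite divn_gt0.
have nE := divn_eq n L.+1; have := ltn_pmod n (ltn0Sn L).
have := relatively_dense_count (n %/ L.+1) AL.
set q := (n %/ L.+1)%N in q0 nE *; set r := (n %% L.+1)%N in nE * => qc rL.
have : (q <= count (mem A) (index_iota 1 n.+1))%N.
  apply: leq_trans qc _; rewrite /index_iota !subSS !subn0 nE iotaD count_cat.
  exact: leq_addr.
nia.
Qed.

Lemma count_leq_or_dvd (P : pred nat) a L n :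
  (forall k, (0 < k <= n)%N -> P k -> (k <= a)%N || (L %| k)%N) ->
  (count P (index_iota 1 n.+1) <= a + n %/ L)%N.
Proof.
move=> PaL; pose le_a k := (k <= a)%N.
apply: (@leq_trans (count (predU le_a (dvdn L)) (index_iota 1 n.+1))).
  rewrite -!size_filter; apply: uniq_leq_size.
    by rewrite filter_uniq// iota_uniq.
  move=> k; rewrite !mem_filter mem_index_iota => /andP[Pk kn].
  by rewrite kn andbT; apply: PaL.
have -> : (n %/ L = count (dvdn L) (index_iota 1 n.+1))%N.
  rewrite divn_count_dvd -sum1_count [RHS]big_mkcond.
  by apply: eq_bigr => k _; case: (L %| k)%N.
(* Adding the count of the intersection makes inclusion-exclusion applicable. *)
apply: (leq_trans (leq_addr (count (predI le_a (dvdn L)) (index_iota 1 n.+1)) _)).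
rewrite count_predUI leq_add2r -size_filter -[leqRHS](size_iota 1).
apply: uniq_leq_size; first by rewrite filter_uniq// iota_uniq.
by move=> k; rewrite mem_filter mem_index_iota mem_iota => /andP[ka /andP[-> _]].
Qed.

(** * From large subset sums to a relatively dense counterexample *)

Section Converse.
Variables (R : realType) (K : numFieldType) (re : K -> R).
Hypothesis hK : real_or_complex re.
Variable X : normedModType K.
Implicit Types x : nat -> X.

(** The two sums differ by a signed sum over the symmetric difference of [P] and [Q]. *)
Lemma re_norm_sum_diff x (M : R) (P Q : pred nat) n :
  (forall k, (0 < k)%N -> re `|x k| <= M) ->
  re `|\sum_(1 <= k < n.+1 | P k) x k| <=
  re `|\sum_(1 <= k < n.+1 | Q k) x k| +
  M * (count (fun k => P k != Q k) (index_iota 1 n.+1))%:R.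
Proof.
move=> xM.
have -> : \sum_(1 <= k < n.+1 | P k) x k = \sum_(1 <= k < n.+1 | Q k) x k +
    \sum_(1 <= k < n.+1 | P k != Q k) (if P k then x k else - x k).
  rewrite !(big_mkcond (fun k => P k)) !(big_mkcond (fun k => Q k)).
  rewrite (big_mkcond (fun k => P k != Q k)) -big_split/=.
  apply: eq_bigr => k _; case: (P k) (Q k) => [] []/=.
  - by rewrite addr0.
  - by rewrite add0r.
  - by rewrite subrr.
  - by rewrite addr0.
apply: le_trans (re_normD hK _ _) _; rewrite lerD2l.
apply: le_trans (re_norm_sum hK _ _ _) _.
rewrite -sum1_count natr_sum mulr_sumr big_nat_cond [leRHS]big_nat_cond.
apply: ler_sum => k /andP[/andP[k0 _] _]; rewrite mulr1.
by case: ifP => _; rewrite ?normrN xM.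
Qed.

Lemma ergodic_small_subset_sums x :
  [bounded x k | k in [set k : nat | (0 < k)%N]] ->
  (forall k, increasing_pos k -> relatively_dense (terms k) ->
    ergodic_along x k) ->
  small_subset_sums re x.
Proof.
move=> xb xerg; have [M M0 xM] := bounded_re hK xb.
apply: contrapT => /existsNP[e /not_implyP[e0 /forallNP xbad]].
have bad n0 : exists nP : nat * pred nat, (n0 <= nP.1)%N /\
    e * nP.1%:R < re `|\sum_(1 <= k < nP.1.+1 | nP.2 k) x k|.
  have /existsNP[n /existsNP[P /not_implyP[n0n /negP]]] := xbad n0.
  by rewrite -ltNge => ?; exists (n, P).
have [pick pickP] := choice bad.
(* With this [L], the errors [M * N i] and [M * (n %/ L)] will each be at most [e * n / 4]; the
   successor keeps [L] positive. *)
pose L := (Num.bound (4 * M / e)).+1.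
have ML : 4 * M <= e * L%:R.
  rewrite -ler_pdivrMl// mulrC ltW// (lt_le_trans (archi_boundP _))//.
    by rewrite !mulr_ge0// invr_ge0 ltW.
  by rewrite ler_nat leqnSn.
(* The factor [L] makes all earlier blocks negligible; [a.+1] forces strict growth even from
   [a = 0]. *)
pose next a := pick (L * a.+1)%N.
pose N i := iter i (fun a => (next a).1) 0%N.
have N_big i : (L * (N i).+1 <= N i.+1)%N by have [] := pickP (L * (N i).+1)%N.
have N_lt i : (N i < N i.+1)%N.
  by apply: leq_trans (N_big i); rewrite leq_pmull.
have N_mono i j : (i <= j)%N -> (N i <= N j)%N.
  by apply: (homo_leq leqnn leq_trans) => {}i; exact: ltnW.
have N_ge i : (i <= N i)%N by elim: i => // i /leq_ltn_trans; apply.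
pose block i := [set k | (N i < k <= N i.+1)%N].
have block_inj i j k : block i k -> block j k -> i = j.
  move=> /andP[ik ki] /andP[jk kj]; case: (ltngtP i j) => // /N_mono ij.
    by have := leq_ltn_trans (leq_trans ki ij) jk; rewrite ltnn.
  by have := leq_ltn_trans (leq_trans kj ij) ik; rewrite ltnn.
pose A := [set k | (L %| k)%N \/ exists2 i, block i k & (next (N i)).2 k].
have [|k kP kA] := @enumerate_infinite A.
  move=> a; exists (a.+1 * L)%N; first by left; exact: dvdn_mull.
  by rewrite (leq_trans _ (leq_pmulr _ _)).
have kdense : relatively_dense (terms k).
  (* The largest multiple of [L] up to [a + L] exceeds [a]. *)
  exists L => // a b a0 ab; exists ((a + L) %/ L * L)%N.
    rewrite kA; split; first by left; exact: dvdn_mull.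
    by rewrite /= muln_gt0 divn_gt0// leq_addl.
  have := divn_eq (a + L) L; have := ltn_pmod (a + L) (ltn0Sn _ : 0 < L)%N.
  by move: ab; lia.
have e4 : 0 < e / 4 by rewrite divr_gt0.
have [m0 hm0] := (ergodic_alongP hK x k).1 (xerg k kP kdense) _ e4.
(* Since [N] dominates the identity, [k m0.+1 <= n]: more than [m0] terms lie up to [n], and the
   ergodic bound applies there. *)
pose i := k m0.+1; pose n := N i.+1.
have [m km] := increasing_pos_last n kP.
have m0m : (m0 < m)%N by rewrite -km// (leq_trans (N_ge _))// ltnW.
have mn : (m <= n)%N.
  apply: leq_trans (increasing_pos_ge m kP) _.
  by rewrite km// (leq_trans _ m0m).
have [_] := pickP (L * (N i).+1)%N; rewrite -/(next (N i)) -[(next _).1]/n.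
set P := (next (N i)).2 => Pbad.
have := re_norm_sum_diff P (fun j => j \in terms k) n xM.
(* Above [N i] and off the multiples of [L], disjointness of the blocks leaves only the predicate of
   block [i], which is [P]. *)
have cnt : (count (fun j => P j != (j \in terms k)) (index_iota 1 n.+1) <=
    N i + n %/ L)%N.
  apply: count_leq_or_dvd => j /andP[j0 jn] PA; apply/orP.
  have [|ij] := leqP j (N i); first by left.
  right; apply: contraNT PA => Lj; apply/eqP; rewrite kA.
  apply/idP/idP => [Pj|/set_mem[[Lj'|[i' ji' Pj]] _]].
  - by apply/mem_set; split => //; right; exists i => //; apply/andP.
  - by rewrite Lj' in Lj.
  - by rewrite /P (@block_inj i i' j)//; apply/andP.
rewrite -(sum_terms _ kP km) => /(lt_le_trans Pbad).
have := hm0 m (ltnW m0m).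
have nL : ((n %/ L) * L <= n)%N by exact: leq_trunc_div.
have LN : (L * (N i) <= n)%N.
  by apply: leq_trans (N_big i); rewrite leq_mul2l leqnSn orbT.
set S := re `|_|; set c := count _ _ in cnt *; set q := (n %/ L)%N in nL cnt.
move=> Sle bad_lt.
have mnR : m%:R <= n%:R :> R by rewrite ler_nat.
have cR : c%:R <= (N i)%:R + q%:R :> R by rewrite -natrD ler_nat.
have nLR : q%:R * L%:R <= n%:R :> R by rewrite -natrM ler_nat.
have LNR : L%:R * (N i)%:R <= n%:R :> R by rewrite -natrM ler_nat.
have Mc : M * c%:R <= M * (N i)%:R + M * q%:R by rewrite -mulrDr ler_wpM2l.
have MN : 4 * M * (N i)%:R <= e * n%:R.
  apply: le_trans (ler_wpM2r _ ML) _ => //.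
  by rewrite -mulrA ler_pM2l.
have Mq : 4 * M * q%:R <= e * n%:R.
  apply: le_trans (ler_wpM2r _ ML) _ => //.
  by rewrite -mulrA ler_pM2l// mulrC.
have em : e * m%:R <= e * n%:R by rewrite ler_pM2l.
have en : 0 <= e * n%:R by rewrite mulr_ge0// ltW.
(* Together these give [e * n < e * m / 4 + e * n / 4 + e * n / 4], which is at most
   [3 * e * n / 4]: a contradiction. *)
lra.
Qed.

End Converse.

Theorem theorem2p3 (R : realType) (K : numFieldType) (re : K -> R)
    (hK : real_or_complex re) (X : completeNormedModType K) (x : nat -> X)
    (x_bounded : [bounded x k | k in [set k : nat | (0 < k)%N]]) :
  (uniformly_weakly_mixing re x <->
   forall k : nat -> nat, increasing_pos k ->
     (0 < lower_density R (terms k))%E -> ergodic_along x k) /\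
  ((forall k : nat -> nat, increasing_pos k ->
     (0 < lower_density R (terms k))%E -> ergodic_along x k) <->
   forall k : nat -> nat, increasing_pos k ->
     relatively_dense (terms k) -> ergodic_along x k).
Proof.
have j_jj : uniformly_weakly_mixing re x -> forall k, increasing_pos k ->
    (0 < lower_density R (terms k))%E -> ergodic_along x k.
  move=> /(mixing_small_subset_sums hK) xs k.
  exact: small_subset_sums_ergodic xs.
have jj_jjj : (forall k, increasing_pos k ->
    (0 < lower_density R (terms k))%E -> ergodic_along x k) ->
    forall k, increasing_pos k -> relatively_dense (terms k) -> ergodic_along x k.
  by move=> xjj k kP /(relatively_dense_lower_density R); exact: xjj.
have jjj_j : (forall k, increasing_pos k -> relatively_dense (terms k) ->
    ergodic_along x k) -> uniformly_weakly_mixing re x.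
  move=> xjjj; apply/(mixing_small_subset_sums hK).
  exact: ergodic_small_subset_sums.
by split; split=> //; [move=> /jj_jjj/jjj_j|move=> /jjj_j/j_jj].
Qed.
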